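(* For any graph $H$ and any $q \in [1,2)$ there is a constant $B>0$ (depending only on $H,q$), and for any $C>0$ there is a constant $A>0$ (depending only on $H,q,C$), such that for every $\epsilon \in (0,1)$ there exists $$\delta \ge \exp\left(-A\,\epsilon^{-B}\right)$$ for which the following holds. Let $G$ be an $n$-vertex graph satisfying $\|\lambda^G\|_q \le C n$, where $(\lambda^G_i)_{i\ge1}$ are the eigenvalues of the adjacency matrix of $G$. If $\mathrm{Hom}(H,G) \le \delta n^{|V(H)|}$, then one can remove at most $\epsilon n^2$ edges from $G$ to eliminate all homomorphic copies of $H$ (i.e. so that the resulting graph $G'$ has $\mathrm{Hom}(H,G')=0$).
   Context: Graphs are finite, unweighted, undirected and simple; $n\ge 1$. $\mathrm{Hom}(H,G)$ is the number of graph homomorphisms from $H$ to $G$. $\|\lambda^G\|_q := \left(\sum_i |\lambda_i^G|^q\right)^{1/q}$, with eigenvalues counted with multiplicity. *)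

(* Defs.v *)
From HB Require Import structures.
From mathcomp Require Import all_boot all_order all_algebra.
From mathcomp Require Import sesquilinear spectral complex.
From mathcomp Require Import boolp classical_sets reals exp.

Set Implicit Arguments.
Unset Strict Implicit.
Unset Printing Implicit Defensive.

Import Order.TTheory GRing.Theory Num.Theory.

Local Open Scope ring_scope.

Record sgraph := SGraph {
  vertex :> finType;
  adj : rel vertex;
  adj_sym : symmetric adj;
  adj_irr : irreflexive adj }.

Definition edges (G : sgraph) : {set {set G}} :=
  [set [set x; y] | x in G, y in G & adj x y].

Definition nhom (H G : sgraph) : nat :=
  #|[set f : {ffun H -> G} |
      [forall x, forall y, adj x y ==> adj (f x) (f y)]]|.

Section Deletion.
Variables (G : sgraph) (F : {set {set G}}).

Definition del_rel : rel G := fun x y => adj x y && ([set x; y] \notin F).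

Lemma del_rel_sym : symmetric del_rel.
Proof. by move=> x y; rewrite /del_rel adj_sym finset.setUC. Qed.

Lemma del_rel_irr : irreflexive del_rel.
Proof. by move=> x; rewrite /del_rel adj_irr. Qed.

Definition del_edges : sgraph := SGraph del_rel_sym del_rel_irr.

End Deletion.

Definition adjmx (R : realType) (G : sgraph) : 'M[R]_#|G| :=
  \matrix_(i, j) (adj (enum_val i) (enum_val j))%:R.

(* The eigenvalues of A in R, repeated according to algebraic multiplicity.
   They are determined up to order; the value is [::] when the characteristic
   polynomial of A does not split over R, which cannot happen for a symmetric
   A (eigenvalues_sym below). *)
Definition eigenvalues (R : realType) (n : nat) (A : 'M[R]_n) : seq R :=
  xget [::] [set s | char_poly A = \prod_(x <- s) ('X - x%:P)]%classic.

Definition eigenvalue_norm (R : realType) (q : R) (n : nat) (A : 'M[R]_n) : R :=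
  (\sum_(x <- eigenvalues A) `|x| `^ q) `^ q^-1.

Lemma sym_char_poly_split (R : rcfType) (n : nat) (A : 'M[R]_n) :
  A^T = A -> exists s : seq R, char_poly A = \prod_(x <- s) ('X - x%:P).
Proof.
move=> symA; pose f := real_complex R; pose B := map_mx f A.
have Bherm : B \is hermsymmx.
  apply: realsym_hermsym.
    by apply/is_hermitianmxP; rewrite expr0 scale1r map_mx_id // map_trmx symA.
  by apply/mxOverP=> i j; rewrite mxE complex_real.
have /orthomx_spectralP eB := hermitian_normalmx Bherm.
have dreal := hermitian_spectral_diag_real Bherm.
set d := spectral_diag B in eB dreal; set P := spectralmx B in eB.
have Pu : P \in unitmx by exact: spectral_unit.
exists [seq complex.Re (d ord0 i) | i <- enum 'I_n].
apply: (map_poly_inj f); rewrite map_char_poly -/B rmorph_prod /= big_map.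
have -> : char_poly B = char_poly (diag_mx d).
  rewrite {1}eB /char_poly /char_poly_mx !map_mxM /=.
  set Q := map_mx polyC P.
  have Qu : map_mx polyC (invmx P) *m Q = 1%:M.
    by rewrite -map_mxM mulVmx // map_mx1.
  have {1}-> : 'X%:M = map_mx polyC (invmx P) *m 'X%:M *m Q.
    by rewrite scalar_mxC -mulmxA Qu mulmx1.
  by rewrite -mulmxBl -mulmxBr !det_mulmx mulrAC -det_mulmx Qu det1 mul1r.
rewrite char_poly_trig ?diag_mx_is_trig // big_enum; apply: eq_bigr => i _.
rewrite rmorphB /= map_polyX map_polyC /= mxE eqxx mulr1n.
by congr ('X - _%:P); rewrite [RHS]RRe_real // (mxOverP dreal).
Qed.

Lemma eigenvalues_sym (R : realType) (n : nat) (A : 'M[R]_n) :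
  A^T = A -> char_poly A = \prod_(x <- eigenvalues A) ('X - x%:P).
Proof. by move=> /sym_char_poly_split; apply: xgetPex. Qed.

Lemma adjmx_sym (R : realType) (G : sgraph) : (adjmx R G)^T = adjmx R G.
Proof. by apply/matrixP=> i j; rewrite !mxE adj_sym. Qed.

(* Main.v *)
(** If the Schatten q-norm of the adjacency matrix A is at most C n with q < 2,
    then only boundedly many eigenvalues exceed tau n in absolute value, and
    the others contribute at most C^q tau^(2-q) n^2 to the sum of squares.
    Rounding the coordinates of the rows of A along the large eigenvectors puts
    the vertices into exp(poly(1/eps)) cells such that, on average, two rows in
    the same cell are close in Hamming distance.  Hence almost all edges lie
    between cells that are large and almost completely joined.  Delete the
    other edges: if a copy of H survives, a union bound over the edges of H
    shows that half of all the maps sending each vertex of H into the cell of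
    its image are homomorphisms to G, which is too many. *)
Require Import Defs.
From mathcomp Require Import all_boot all_order all_algebra.
From mathcomp Require Import reals sequences exp.
From mathcomp Require Import sesquilinear spectral complex ring lra zify.

Import Order.TTheory GRing.Theory Num.Theory.
Local Open Scope ring_scope.
Local Open Scope sesquilinear_scope.
Set Implicit Arguments.
Unset Strict Implicit.
Unset Printing Implicit Defensive.

(** * Real spectral coordinates for the rows of a symmetric matrix *)

Lemma Re_mul_conj (R : rcfType) (z w : R[i]) :
  complex.Re (z * Num.conj w) =
  complex.Re z * complex.Re w + complex.Im z * complex.Im w.
Proof. case: z w => a b [c d] /=; ring. Qed.

Lemma Re_sum (R : rcfType) (I : Type) (r : seq I) (P : pred I) (F : I -> R[i]) :
  complex.Re (\sum_(i <- r | P i) F i) = \sum_(i <- r | P i) complex.Re (F i).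
Proof. by apply: (big_morph (@complex.Re R)) => // -[a b] [c d]. Qed.

(** The rows of A are written in a unitary eigenbasis: inner products of rows are preserved, and
    column k of the coordinates is [mu k] times a unit vector. The basis is complex, so each
    coordinate counts as two real ones, whence the index ['I_n * bool]. *)
Lemma spectral_coordinates (R : realType) n (A : 'M[R]_n) : A^T = A ->
  exists (mu : 'I_n -> R) (Z : 'I_n -> 'I_n * bool -> R),
  [/\ forall f : R -> R, \sum_(x <- eigenvalues A) f x = \sum_k f (mu k),
      forall i j, \sum_p Z i p * Z j p = \sum_k A i k * A j k
    & forall k, \sum_i (Z i (k, true) ^+ 2 + Z i (k, false) ^+ 2) = mu k ^+ 2].
Proof.
move=> symA; pose f := real_complex R.
have [B BE] : {B | B = map_mx f A} by exists (map_mx f A).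
have Btr : B^T = B by rewrite BE map_trmx symA.
have fC x : Num.conj (f x) = f x by apply/CrealP; rewrite complex_real.
have Bconj : map_mx Num.conj B = B.
  by apply/matrixP=> i j; rewrite BE !mxE fC.
have Bherm : B \is hermsymmx.
  by apply/is_hermitianmxP; rewrite expr0 scale1r Btr Bconj.
have [P [d [Pun dreal eB]]] : exists P (d : 'rV_n),
    [/\ P \is unitarymx, d \is a mxOver Num.real & B = invmx P *m diag_mx d *m P].
  exists (spectralmx B), (spectral_diag B); split.
  - exact: spectral_unitarymx.
  - exact: hermitian_spectral_diag_real.
  - exact/orthomx_spectralP/hermitian_normalmx.
have Pu : P \in unitmx by exact: unitarymx_unit.
have PPt : P *m P ^t* = 1%:M by apply/unitarymxP.
have PtP : P ^t* *m P = 1%:M by rewrite -invmx_unitary // mulVmx.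
have dE k : d 0 k = f (complex.Re (d 0 k)).
  by rewrite /f /= RRe_real // (mxOverP dreal).
pose Y := B *m P ^t*.
have YE : Y = P ^t* *m diag_mx d.
  by rewrite /Y {1}eB (invmx_unitary Pun) -[LHS]mulmxA PPt mulmx1.
exists (fun k => complex.Re (d 0 k)).
(* Row i of A has coordinates Y i k in the complex eigenbasis; Z i (k, true)
   and Z i (k, false) are their real and imaginary parts. *)
exists (fun i p => if p.2 then complex.Re (Y i p.1) else complex.Im (Y i p.1)).
split.
- move=> g.
  (* [eigenvalues A] is fixed only up to order, so it is matched with the spectral diagonal through
     the factorisation of the characteristic polynomial. *)
  have pE : perm_eq (eigenvalues A) [seq complex.Re (d 0 k) | k <- enum 'I_n].
    apply: prod_XsubC_eq; rewrite -(eigenvalues_sym symA).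
    apply: (map_poly_inj f); rewrite map_char_poly -BE rmorph_prod /= big_map.
    have simB : map_mx polyC P *m char_poly_mx B =
        char_poly_mx (diag_mx d) *m map_mx polyC P.
      rewrite /char_poly_mx mulmxBr mulmxBl scalar_mxC -!map_mxM.
      congr (_ - map_mx _ _).
      by rewrite eB !mulmxA (mulmxV Pu) mul1mx.
    have detP : \det (map_mx polyC P) != 0.
      by rewrite det_map_mx polyC_eq0 -unitfE -unitmxE.
    have -> : char_poly B = char_poly (diag_mx d).
      apply: (mulfI detP).
      have := congr1 determinant simB; rewrite !det_mulmx => e.
      by rewrite [LHS]e mulrC.
    rewrite char_poly_trig ?diag_mx_is_trig // big_enum; apply: eq_bigr => k _.
    by rewrite rmorphB /= map_polyX map_polyC /= mxE eqxx mulr1n dE.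
  by rewrite (perm_big _ pE) big_map big_enum.
- move=> i j.
  have YY : (Y *m Y ^t*) i j = f (\sum_k A i k * A j k).
    have -> : Y *m Y ^t* = B *m B.
      rewrite trmx_mul map_mxM Btr Bconj /= mulmxA -(mulmxA B) trmxCK PtP.
      by rewrite mulmx1.
    rewrite mxE /f rmorph_sum; apply: eq_bigr => k _.
    by rewrite BE !mxE -rmorphM -{2}symA mxE.
  have {YY} := congr1 (@complex.Re R) YY; rewrite /= => <-.
  pose T k (b : bool) := (if b then complex.Re (Y i k) else complex.Im (Y i k)) *
    (if b then complex.Re (Y j k) else complex.Im (Y j k)).
  rewrite mxE Re_sum -[LHS](pair_bigA _ T).
  apply: eq_bigr => k _; rewrite big_bool /T !mxE /=.
  by rewrite Re_mul_conj.
- move=> k.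
  have YY : (Y ^t* *m Y) k k = f (complex.Re (d 0 k) ^+ 2).
    rewrite YE trmx_mul map_mxM /= mulmxA -(mulmxA _ _ (P ^t*)) trmxCK PPt mulmx1.
    rewrite tr_diag_mx map_diag_mx mulmx_diag !mxE eqxx mulr1n.
    move: (dE k); set r := complex.Re _ => ->.
    transitivity (f r * f r); first by congr (_ * _); exact: fC.
    by rewrite -rmorphM expr2.
  have {YY} := congr1 (@complex.Re R) YY; rewrite /= => <-.
  rewrite mxE Re_sum; apply: eq_bigr => i _.
  by rewrite !mxE mulrC Re_mul_conj -!expr2.
Qed.

(** Each coordinate is mapped affinely from [-b, b] to [0, g] and truncated; points with equal
    integer parts are within 1 there, hence within 2b/g originally. The endpoint b is sent to g, so
    g + 1 labels are needed. *)
Lemma grid_partition (R : realType) (T J : finType) (Z : T -> J -> R) (b : R)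
    (g : nat) : 0 < b -> (0 < g)%N -> (forall t j, `|Z t j| <= b) ->
  exists c : T -> {ffun J -> 'I_g.+1},
    forall t t' j, c t = c t' -> `|Z t j - Z t' j| <= 2 * b / g%:R.
Proof.
move=> b0 g0 Zb; have g0R : 0 < g%:R :> R by rewrite ltr0n.
pose u t j := (Z t j + b) * g%:R / (2 * b).
have u_ge0 t j : 0 <= u t j.
  have := Zb t j; rewrite ler_norml => /andP[lo _].
  by rewrite divr_ge0 ?mulr_ge0 ?(ltW b0) ?(ltW g0R) //; lra.
have u_le t j : (Num.trunc (u t j) < g.+1)%N.
  have := Zb t j; rewrite ler_norml => /andP[_ hi].
  rewrite ltnS -(ler_nat R); apply: (le_trans (y := u t j)).
    by rewrite truncn_le.
  rewrite /u ler_pdivrMr ?mulr_gt0 // mulrC ler_pM2l //; last lra.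
exists (fun t => [ffun j => Ordinal (u_le t j)]) => t t' j /ffunP/(_ j).
rewrite !ffunE => -[e].
have /andP[a1 a2] := truncn_itv (u_ge0 t j).
have /andP[a3 a4] := truncn_itv (u_ge0 t' j).
rewrite e in a1 a2.
have ->: Z t j - Z t' j = (u t j - u t' j) * (2 * b / g%:R).
  by rewrite /u; field; rewrite !gt_eqF.
rewrite normrM [X in _ * X]ger0_norm; last first.
  by rewrite divr_ge0 ?mulr_ge0 ?(ltW b0) ?(ltW g0R).
rewrite ler_piMl ?divr_ge0 ?mulr_ge0 ?(ltW b0) ?(ltW g0R) //.
move: a2 a4; rewrite -natr1 ler_norml => a2 a4; apply/andP; split; lra.
Qed.

(** * Homomorphisms inside a product of vertex sets *)

Definition nonadj (G : sgraph) (X Y : {set G}) : {set G * G} :=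
  [set p | [&& p.1 \in X, p.2 \in Y & ~~ adj p.1 p.2]].

Lemma card_family_prod (I T : finType) (W : I -> {set T}) :
  #|[set f : {ffun I -> T} | [forall z, f z \in W z]]| = (\prod_z #|W z|)%N.
Proof.
have -> : (\prod_z #|W z| = foldr muln 1 [seq #|W z| | z : I])%N.
  by rewrite foldrE big_map big_enum.
rewrite -(@card_family I (fun=> T) (fun z => mem (W z))) cardsE.
by apply: eq_card => f; apply/forallP/familyP => h z; exact: h.
Qed.

(** For f uniform in the product of the [W z], the pair (f x, f y) is uniform in the product of
    [W x] and [W y], because x and y differ. The equality of densities is cross-multiplied to stay
    in the naturals. *)
Lemma card_family_nonadj (H : finType) (G : sgraph) (W : H -> {set G}) x y :
  x != y ->
  (#|[set f : {ffun H -> G} | [forall z, f z \in W z] && ~~ adj (f x) (f y)]|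
     * (#|W x| * #|W y|) = #|nonadj (W x) (W y)| * \prod_z #|W z|)%N.
Proof.
move=> xy; set B := [set _ | _].
pose r := (\prod_(z | (z != x) && (z != y)) #|W z|)%N.
have -> : (\prod_z #|W z| = #|W x| * #|W y| * r)%N.
  by rewrite (bigD1 x) // (bigD1 y) 1?eq_sym //= mulnA.
suff -> : #|B| = (#|nonadj (W x) (W y)| * r)%N by rewrite mulnAC -mulnA.
rewrite -sum1_card (partition_big (fun f : {ffun H -> G} => (f x, f y))
  (mem (nonadj (W x) (W y)))) /=; last first.
  by move=> f; rewrite !inE /= => /andP[/forallP fW ->]; rewrite !fW.
rewrite -sum_nat_const; apply: eq_bigr => -[a b] /[!inE] /= /and3P[ax bY ab].
(* Prescribing f x = a and f y = b leaves a product family again, with two singleton factors. *)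
pose V z := if z == x then [set a] else if z == y then [set b] else W z.
have -> : r = (\prod_z #|V z|)%N.
  rewrite [RHS](bigD1 x) //= [in RHS](bigD1 y) 1?eq_sym //= {1 2}/V.
  rewrite !eqxx eq_sym (negPf xy) !cards1 !mul1n.
  by apply: eq_bigr => z /andP[/negPf zx /negPf zy]; rewrite /V zx zy.
rewrite -card_family_prod -sum1_card; apply: eq_bigl => f; rewrite !inE /=.
apply/idP/forallP => [/andP[/andP[/forallP fW _] /eqP[fx fy]] z|fV].
  rewrite /V; case: eqP => [->|_]; first by rewrite fx set11.
  by case: eqP => [->|_]; rewrite ?fy ?set11.
have fx : f x = a by have := fV x; rewrite /V eqxx inE => /eqP.
have fy : f y = b.
  by have := fV y; rewrite /V eq_sym (negPf xy) eqxx inE => /eqP.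
rewrite fx fy ab eqxx !andbT; apply/forallP => z.
have := fV z; rewrite /V; case: eqP => [->|_]; first by rewrite fx.
by case: eqP => [->|_]; rewrite ?fy.
Qed.

(** Union bound: each of the at most m ordered edges of H spoils at most a fraction 1/(2m) of the
    maps, so at least half of them are homomorphisms. *)
Lemma nhom_ge_prod (H G : sgraph) (m : nat) (W : H -> {set G}) :
  (0 < m)%N -> (#|H| ^ 2 <= m)%N -> (forall x, 0 < #|W x|)%N ->
  (forall x y, adj x y -> #|nonadj (W x) (W y)| * (2 * m) <= #|W x| * #|W y|)%N ->
  (\prod_x #|W x| <= 2 * nhom H G)%N.
Proof.
move=> m0 hm W0 Wadj; rewrite -card_family_prod.
set fam := [set _ | _]; pose hom := [set f : {ffun H -> G} |
      [forall x, forall y, adj x y ==> adj (f x) (f y)]].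
pose bad x y := [set f : {ffun H -> G} |
  [forall z, f z \in W z] && ~~ adj (f x) (f y)].
have badP x y : adj x y -> (#|bad x y| * (2 * m) <= #|fam|)%N.
  move=> xy; have xNy : x != y.
    by apply: contraTneq xy => ->; rewrite adj_irr.
  have p0 : (0 < #|W x| * #|W y|)%N by rewrite muln_gt0 !W0.
  rewrite -(leq_pmul2r p0) mulnAC card_family_nonadj // card_family_prod.
  by rewrite mulnAC [leqRHS]mulnC leq_mul2r Wadj // orbT.
have cover : (#|fam| <= #|hom| + \sum_(p : H * H | adj p.1 p.2) #|bad p.1 p.2|)%N.
  have sub : fam \subset hom :|: \bigcup_(p : H * H | adj p.1 p.2) bad p.1 p.2.
    apply/fintype.subsetP => f; rewrite !inE => fW.
    case: forallP => //= /forallP/forallPn[x /forallPn[y]].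
    rewrite negb_imply => /andP[xy nxy].
    by apply/bigcupP; exists (x, y); rewrite // inE fW.
  apply: leq_trans (subset_leq_card sub) _.
  apply: leq_trans (leq_card_setU _ _) _; rewrite leq_add2l.
  elim/big_rec2: _ => [|p s S _ IH]; first by rewrite cards0.
  by apply: leq_trans (leq_card_setU _ _) _; rewrite leq_add2l.
have sumbad :
    ((\sum_(p : H * H | adj p.1 p.2) #|bad p.1 p.2|) * (2 * m) <= m * #|fam|)%N.
  rewrite big_distrl /=.
  apply: (@leq_trans (\sum_(p : H * H | adj p.1 p.2) #|fam|)).
    by apply: leq_sum => p; exact: badP.
  rewrite sum_nat_const leq_mul2r; apply/orP; right.
  by apply: leq_trans (max_card _) _; rewrite card_prod mulnn.
rewrite -(leq_pmul2l m0).
have : (#|fam| * (2 * m) <= #|hom| * (2 * m) + m * #|fam|)%N.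
  apply: leq_trans (leq_mul cover (leqnn _)) _.
  by rewrite mulnDl leq_add2l.
rewrite /nhom -/hom; move: #|fam| #|hom| => u v; nia.
Qed.

(** * Resampling vertices inside the cells of a partition *)

Section Cells.
Variables (R : realType) (G : sgraph) (L : finType) (c : G -> L).

Definition cell (i : G) : {set G} := [set j | c j == c i].

(** Transition probabilities of replacing i by a uniform vertex of its cell: a symmetric stochastic
    matrix. *)
Definition kernel (i j : G) : R := (c j == c i)%:R / #|cell i|%:R.

Lemma mem_cell i : i \in cell i.
Proof. by rewrite inE. Qed.

Lemma card_cell_gt0 i : (0 < #|cell i|)%N.
Proof. by apply/card_gt0P; exists i; exact: mem_cell. Qed.

Lemma kernel_ge0 i j : 0 <= kernel i j.
Proof. by rewrite divr_ge0. Qed.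

Lemma kernelC i j : kernel i j = kernel j i.
Proof.
rewrite /kernel eq_sym; case: eqP => [e|_]; last by rewrite !mul0r.
by rewrite /cell e.
Qed.

Lemma kernel_sum (i : G) (f : G -> R) :
  \sum_j kernel i j * f j = (\sum_(j in cell i) f j) / #|cell i|%:R.
Proof.
rewrite big_distrl [RHS]big_mkcond /=; apply: eq_bigr => j _.
by rewrite /kernel inE; case: eqP => _; rewrite ?mul0r // mul1r mulrC.
Qed.

Lemma kernel_sum1 i : \sum_j kernel i j = 1.
Proof.
transitivity (\sum_j kernel i j * 1); first by apply: eq_bigr => j _; rewrite mulr1.
by rewrite kernel_sum sumr_const divff // pnatr_eq0 -lt0n card_cell_gt0.
Qed.

(** Each label accounts for at most t such vertices: they all lie in one cell, which has fewer than
    t elements. *)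
Lemma card_small_cells (t : R) : 0 <= t ->
  #|[set i | #|cell i|%:R < t]|%:R <= #|L|%:R * t.
Proof.
move=> t0; rewrite -sum1_card (partition_big c predT) //= natr_sum.
rewrite -sum1_card natr_sum big_distrl /=; apply: ler_sum => l _.
rewrite mul1r sum1_card; set B := (X in #|X|).
have [i iB|B0] := pickP B; last by rewrite eq_card0.
move: (iB); rewrite /B inE => /andP[/ltW it /eqP cil].
apply: le_trans it; rewrite ler_nat; apply/subset_leq_card/fintype.subsetP => j.
by rewrite [_ \in B]unfold_in /B /= !inE cil => /andP[].
Qed.

Definition row_dist (i j : G) : nat := #|[set k | adj i k != adj j k]|.

(** Both sides are the probability that independent uniform vertices of the two cells are
    non-adjacent. *)
Lemma nonadj_density i j :
  #|nonadj (cell i) (cell j)|%:R / (#|cell i|%:R * #|cell j|%:R) =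
  \sum_i' \sum_j' kernel i i' * kernel j j' * (~~ adj i' j')%:R :> R.
Proof.
transitivity (\sum_i' kernel i i' * (\sum_j' kernel j j' * (~~ adj i' j')%:R)).
  rewrite kernel_sum; under eq_bigr do rewrite kernel_sum.
  rewrite -big_distrl /= invfM mulrA -mulrA [_^-1 * _]mulrC mulrA.
  congr (_ / _ / _).
  rewrite -sum1_card natr_sum pair_big_dep /= big_mkcond [RHS]big_mkcond /=.
  apply: eq_bigr => -[a b] _; rewrite !inE /=.
  by case: (c a == c i) => //=; case: (c b == c j) => //=; case: (adj a b).
apply: eq_bigr => i' _; rewrite big_distrr /=.
by apply: eq_bigr => j' _; rewrite mulrA.
Qed.

(** Ordered edges whose cells have non-edge density above 1/(2m), the threshold tolerated by
    [nhom_ge_prod]. *)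
Definition sparse_pairs (m : nat) : {set G * G} :=
  [set p | adj p.1 p.2 &&
    (#|cell p.1| * #|cell p.2| < #|nonadj (cell p.1) (cell p.2)| * (2 * m))%N].

(** Markov's inequality: [T] sums, over ordered edges, the probability that resampling both ends
    gives a non-edge, and each sparse pair contributes more than 1/(2m). Resampling one end at a
    time bounds [T] by twice [S]. *)
Lemma card_sparse_pairs (m : nat) :
  #|sparse_pairs m|%:R <=
  (4 * m)%:R * \sum_i \sum_i' kernel i i' * (row_dist i i')%:R :> R.
Proof.
set S := \sum_i _.
pose T := \sum_i \sum_j \sum_i' \sum_j' kernel i i' * kernel j j' *
     (adj i j && ~~ adj i' j')%:R.
have le1 : #|sparse_pairs m|%:R <= (2 * m)%:R * T.
  rewrite -sum1_card natr_sum /T [X in _ * X]pair_bigA /= big_distrr /= big_mkcond.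
  apply: ler_sum => -[i j] _ /=; rewrite inE /=.
  have [aij|_] := boolP (adj i j) => /=; last first.
    apply: mulr_ge0 => //; apply: sumr_ge0 => i' _; apply: sumr_ge0 => j' _.
    by rewrite mulr0.
  rewrite -nonadj_density; case: ifP => [lt|_]; last first.
    by rewrite mulr_ge0 // divr_ge0 // mulr_ge0.
  rewrite mulrA ler_pdivlMr ?mulr_gt0 ?ltr0n ?card_cell_gt0 //.
  by rewrite mul1r -!natrM ler_nat ltnW // [ltnRHS]mulnC.
(* If i j is an edge and i' j' is not, then one of the steps
   (i, j) -> (i', j) -> (i', j') changes the adjacency. *)
have le2 : T <= S + S.
  have -> : S + S = \sum_i \sum_j \sum_i' \sum_j' kernel i i' * kernel j j' *
      ((adj i j != adj i' j)%:R + (adj i' j != adj i' j')%:R).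
    have distE i i' : (row_dist i i')%:R = \sum_j (adj i j != adj i' j)%:R :> R.
      rewrite /row_dist -sum1_card natr_sum [LHS]big_mkcond.
      by apply: eq_bigr => j _; rewrite inE; case: (_ != _).
    (* In the first sum j' has been averaged out. In the second it is i, whose weights sum to 1 for
       fixed i' by symmetry of the kernel. *)
    transitivity (\sum_i \sum_j \sum_i' kernel i i' * (adj i j != adj i' j)%:R
      + \sum_j \sum_i \sum_i' kernel i' i *
          \sum_j' kernel j j' * (adj j i' != adj j' i')%:R).
      congr (_ + _).
        apply: eq_bigr => i _; rewrite exchange_big; apply: eq_bigr => i' _.
        by rewrite distE big_distrr.
      apply: eq_bigr => j _; rewrite exchange_big /=.
      under [RHS]eq_bigr do rewrite -big_distrl /= kernel_sum1 mul1r.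
      rewrite exchange_big; apply: eq_bigr => j' _.
      by rewrite distE big_distrr.
    rewrite [X in _ + X]exchange_big -big_split; apply: eq_bigr => i _ /=.
    rewrite -big_split; apply: eq_bigr => j _ /=.
    rewrite -big_split; apply: eq_bigr => i' _ /=.
    rewrite -[kernel i i' * _]mulr1 -(kernel_sum1 j) !big_distrr -big_split.
    apply: eq_bigr => j' _ /=; rewrite (kernelC i' i) !(adj_sym _ i') /=; ring.
  do 4 (apply: ler_sum => ? _).
  apply: ler_wpM2l; first by apply: mulr_ge0; exact: kernel_ge0.
  rewrite -natrD ler_nat.
  by do 3 case: (adj _ _).
apply: le_trans le1 _.
have -> : (4 * m)%:R * S = (2 * m)%:R * (S + S) by rewrite !natrM; ring.
by rewrite ler_wpM2l.
Qed.

(** The kernel is supported on pairs in a common cell, where the hypothesis applies, and both its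
    row and column sums are 1. *)
Lemma kernel_row_dist (a : R) (r : G -> R) :
  (forall i j, c i = c j -> (row_dist i j)%:R <= a + 2 * r i + 2 * r j) ->
  \sum_i \sum_j kernel i j * (row_dist i j)%:R <=
    a * #|G|%:R + 4 * \sum_i r i.
Proof.
move=> rd.
apply: (@le_trans _ _ (\sum_i \sum_j
  (kernel i j * (a + 2 * r i) + kernel j i * (2 * r j)))).
  apply: ler_sum => i _; apply: ler_sum => j _; rewrite -(kernelC i) -mulrDr.
  rewrite /kernel; case: eqP => [e|_]; last by rewrite !mul0r.
  by rewrite ler_wpM2l ?divr_ge0 // rd.
under eq_bigr do rewrite big_split /=.
rewrite big_split /= [X in _ + X]exchange_big /=.
under eq_bigr do rewrite -big_distrl /= kernel_sum1 mul1r.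
under [X in _ + X]eq_bigr do rewrite -big_distrl /= kernel_sum1 mul1r.
rewrite big_split /= sumr_const -!big_distrr /= -mulr_natr.
by rewrite le_eqVlt; apply/orP; left; apply/eqP; ring.
Qed.
End Cells.

(** * Edge removal from a given partition *)

(** The first term pays for edges with an end in a cell smaller than t, the second for sparse pairs.
    A surviving copy of H would give at least t^|H| / 2 homomorphisms to G by [nhom_ge_prod]. *)
Lemma removal_from_cells (R : realType) (H G : sgraph) (L : finType) (c : G -> L)
    (m : nat) (t : R) :
  (0 < m)%N -> (#|H| ^ 2 <= m)%N -> 0 <= t -> t <= #|G|%:R ->
  2 * (nhom H G)%:R < t ^+ #|H| ->
  exists F : {set {set G}},
    [/\ F \subset edges G,
        #|F|%:R <= 2 * #|G|%:R * (#|L|%:R * t) +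
          (4 * m)%:R * \sum_i \sum_j kernel R c i j * (row_dist i j)%:R
      & nhom H (del_edges F) = 0%N].
Proof.
move=> m0 hm t0 tn few.
pose light := [set i | #|cell c i|%:R < t].
pose bad := [set p : G * G | adj p.1 p.2 && ((p.1 \in light) || (p.2 \in light))]
  :|: sparse_pairs c m.
exists [set [set p.1; p.2] | p in bad]; split.
- apply/fintype.subsetP => _ /imsetP[p pbad ->]; apply/imset2P; exists p.1 p.2 => //.
  by move: pbad; rewrite !inE /= => /orP[] /andP[].
- apply: (@le_trans _ _ #|bad|%:R); first by rewrite ler_nat leq_imset_card.
  apply: (@le_trans _ _ ((2 * #|G| * #|light|)%:R + #|sparse_pairs c m|%:R)).
    rewrite -natrD ler_nat; apply: leq_trans (leq_card_setU _ _) _.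
    rewrite leq_add2r; apply: (@leq_trans #|setX light setT :|: setX setT light|).
      apply/subset_leq_card/fintype.subsetP => p.
      by rewrite !inE andbT /= => /andP[].
    apply: leq_trans (leq_card_setU _ _) _; rewrite !cardsX cardsT.
    by rewrite (mulnC #|light|) addnn -mul2n mulnA.
  apply: lerD (card_sparse_pairs _ _ _).
  by rewrite natrM natrM ler_wpM2l ?mulr_ge0 ?card_small_cells.
- apply/eqP; rewrite eqn0Ngt; apply/negP => /card_gt0P[f].
  rewrite inE => /forallP fhom.
  have {}fhom x y : adj x y -> @adj G (f x) (f y) /\ (f x, f y) \notin bad.
    move=> xy; have := fhom x => /forallP/(_ y)/implyP/(_ xy) /andP[fxy nF].
    split=> //; apply/negP => fbad; case/negP: nF.
    by apply/imsetP; exists (f x, f y).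
  (* An isolated vertex of H may be sent to a small cell, so it gets no
     constraint at all. *)
  pose W x := if [exists y, adj x y] then cell c (f x) else setT.
  have WE x y : adj x y -> W x = cell c (f x).
    by move=> xy; rewrite /W; case: existsP => // -[]; exists y.
  (* For isolated x the set [W x] is the whole vertex set; this is where [t <= #|G|%:R] enters. *)
  have Wt x : t <= #|W x|%:R.
    rewrite /W; case: existsP => [[y xy]|_]; last by rewrite cardsT.
    have [_] := fhom x y xy; rewrite !inE /= negb_or => /andP[+ _].
    have [-> _] := fhom x y xy; rewrite /= negb_or => /andP[+ _].
    by rewrite -leNgt.
  have : (\prod_x #|W x| <= 2 * nhom H G)%N.
    apply: nhom_ge_prod m0 hm _ _ => [x|x y xy].
      rewrite /W; case: ifP => _; first exact: card_cell_gt0.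
      by rewrite cardsT; apply/card_gt0P; exists (f x).
    rewrite (WE x y) // (WE y x) 1?adj_sym //.
    have [fxy] := fhom x y xy; rewrite !inE /= negb_or => /andP[_].
    by rewrite fxy /= -leqNgt.
  rewrite -(ler_nat R) natrM => le2; move: few; rewrite ltNge => /negP; apply.
  apply: le_trans le2; rewrite -prodr_const natr_prod.
  by apply: ler_prod => x _; rewrite t0 Wt.
Qed.

(** * Cells obtained by rounding spectral coordinates *)

(** Distances depend only on inner products, so the Gram identity of [spectral_coordinates]
    transfers to distances between rows. *)
Lemma sum_sqrB (R : comRingType) (J : finType) (u v : J -> R) :
  \sum_j (u j - v j) ^+ 2 =
  \sum_j u j * u j - 2 * \sum_j u j * v j + \sum_j v j * v j.
Proof.
by rewrite big_distrr /= -sumrB -big_split; apply: eq_bigr => j _ /=; ring.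
Qed.

Lemma row_distE (R : realType) (G : sgraph) (x y : G) :
  (row_dist x y)%:R =
  \sum_k (adjmx R G (enum_rank x) k - adjmx R G (enum_rank y) k) ^+ 2.
Proof.
rewrite /row_dist -sum1_card natr_sum big_mkcond (reindex (@enum_val G predT)) /=.
  apply: eq_bigr => k _; rewrite !mxE !enum_rankK inE.
  by case: (adj x _); case: (adj y _) => /=; ring.
exact: onW_bij (enum_val_bij _).
Qed.

(** K counts the eigenvalues above tau n in absolute value and is bounded by Markov's inequality for
    q-th powers. The 2K real coordinates along them are rounded to define the cells; [r i] is the
    squared mass of row i on the remaining ones. *)
Lemma spectral_cells (R : realType) (G : sgraph) (q C tau : R) (g : nat) :
  1 <= q -> q < 2 -> 0 < C -> 0 < tau -> (0 < g)%N -> (0 < #|G|)%N ->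
  eigenvalue_norm q (adjmx R G) <= C * #|G|%:R ->
  exists (K : nat) (L : finType) (c : G -> L) (r : G -> R),
  [/\ K%:R <= (C / tau) `^ q, #|L| = (g.+1 ^ (K * 2))%N,
      \sum_i r i <= C `^ q * tau `^ (2 - q) * #|G|%:R ^+ 2
    & forall i j, c i = c j -> (row_dist i j)%:R <=
        8 * K%:R / g%:R ^+ 2 * #|G|%:R + 2 * r i + 2 * r j].
Proof.
move=> q1 q2 C0 tau0 g0 n0 normA; set n : R := #|G|%:R.
have n0R : 0 < n by rewrite ltr0n.
have g0R : 0 < g%:R :> R by rewrite ltr0n.
have q0 : 0 < q by lra.
have [C0' tau0' n0' q0'] : [/\ 0 <= C, 0 <= tau, 0 <= n & 0 <= q].
  by split; exact: ltW.
have q2' : 0 <= 2 - q by lra.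
have qn0 : q != 0 by rewrite gt_eqF.
have [mu [Z [sumf gram colZ]]] := spectral_coordinates (adjmx_sym R G).
have mu_sum : \sum_k `|mu k| `^ q <= (C * n) `^ q.
  move: normA; rewrite /eigenvalue_norm (sumf (fun x => `|x| `^ q)) => normA.
  have s0 : 0 <= \sum_k `|mu k| `^ q by apply: sumr_ge0 => k _; exact: powR_ge0.
  rewrite -[leLHS](powRr1 s0) -(mulVf qn0) powRrM.
  by apply: ge0_ler_powR => //; rewrite ?nnegrE ?powR_ge0 ?mulr_ge0.
pose large k := tau * n < `|mu k|.
pose J := ({k | large k} * bool)%type.
pose small (i : 'I_#|G|) :=
  \sum_(k | ~~ large k) (Z i (k, true) ^+ 2 + Z i (k, false) ^+ 2).
(* A row of a 0/1 matrix has squared norm at most n. *)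
have Zb i p : `|Z i p| <= Num.sqrt n.
  rewrite -sqrtr_sqr ler_wsqrtr // expr2.
  apply: (@le_trans _ _ (\sum_p Z i p * Z i p)).
    by rewrite (bigD1 p) //= lerDl; apply: sumr_ge0 => ? _; rewrite -expr2 sqr_ge0.
  rewrite gram; apply: (@le_trans _ _ (\sum_(k < #|G|) 1)); last first.
    by rewrite sumr_const card_ord.
  by apply: ler_sum => k _; rewrite !mxE; case: adj; rewrite ?mulr1 ?mulr0.
have b0 : 0 < Num.sqrt n by rewrite sqrtr_gt0.
have b0' := ltW b0.
have [c cP] := @grid_partition R _ J (fun i p => Z i (val p.1, p.2)) _ g b0 g0
  (fun i p => Zb i _).
exists #|[pred k | large k]|, {ffun J -> 'I_g.+1}, (fun x => c (enum_rank x)),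
  (fun x => small (enum_rank x)); split.
- rewrite -(ler_pM2r (powR_gt0 q (mulr_gt0 tau0 n0R))).
  rewrite -powRM ?divr_ge0 ?mulr_ge0 //.
  have -> : C / tau * (tau * n) = C * n by field; rewrite gt_eqF.
  apply: le_trans mu_sum; rewrite -sum1_card natr_sum big_distrl /=.
  rewrite big_mkcond; apply: ler_sum => k _; rewrite inE.
  case: ifP => [/ltW lk|_]; last exact: powR_ge0.
  by rewrite mul1r ge0_ler_powR ?nnegrE ?mulr_ge0.
- by rewrite card_ffun card_ord card_prod card_bool card_sig.
- have -> : \sum_x small (enum_rank x) = \sum_i small i.
    by rewrite [RHS](reindex (@enum_rank G)) //; exact: onW_bij (enum_rank_bij _).
  rewrite exchange_big /=.
  (* For a small eigenvalue, |mu|^2 = |mu|^q |mu|^(2-q) with |mu| <= tau n and 2 - q > 0. *)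
  apply: (@le_trans _ _ (\sum_k `|mu k| `^ q * (tau * n) `^ (2 - q))).
    rewrite big_mkcond; apply: ler_sum => k _; rewrite colZ.
    case: ifP => [|_]; last by rewrite mulr_ge0 ?powR_ge0.
    rewrite -leNgt => sk; rewrite -real_normK ?num_real // -powR_mulrn //.
    have {1}-> : 2%:R = q + (2 - q) by ring.
    rewrite powRD; last by apply/implyP => /eqP; lra.
    by rewrite ler_wpM2l ?powR_ge0 ?ge0_ler_powR ?nnegrE ?mulr_ge0.
  rewrite -big_distrl /= (le_trans (ler_wpM2r (powR_ge0 _ _) mu_sum)) //.
  rewrite !powRM //.
  have -> : n ^+ 2 = n `^ q * n `^ (2 - q).
    rewrite -powRD; last by rewrite (gt_eqF n0R) implybT.
    by rewrite addrC subrK powR_mulrn.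
  by rewrite le_eqVlt; apply/orP; left; apply/eqP; ring.
- move=> x y /cP cxy; rewrite (row_distE R) sum_sqrB -!gram -sum_sqrB.
  set i := enum_rank x in cxy *; set j := enum_rank y in cxy *.
  pose D k b := (Z i (k, b) - Z j (k, b)) ^+ 2.
  have -> : \sum_p (Z i p - Z j p) ^+ 2 = \sum_k (D k true + D k false).
    transitivity (\sum_p D p.1 p.2); first by apply: eq_bigr => -[].
    by rewrite -(pair_bigA _ D); apply: eq_bigr => k _; rewrite big_bool.
  rewrite (bigID large) /= -addrA lerD //.
    (* Each large k carries two real coordinates, each off by at most 2 sqrt(n) / g. *)
    apply: (@le_trans _ _ (\sum_(k | large k) 8 / g%:R ^+ 2 * n)).
      have Dle k b (lk : large k) : D k b <= 4 / g%:R ^+ 2 * n.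
        have := cxy (Sub k lk, b); rewrite /= => le1.
        rewrite /D -real_normK ?num_real //.
        have -> : 4 / g%:R ^+ 2 * n = (2 * Num.sqrt n / g%:R) ^+ 2.
          rewrite !exprMn sqr_sqrtr // exprVn -natrX /=; ring.
        by rewrite ler_sqr ?nnegrE // divr_ge0 ?mulr_ge0.
      apply: ler_sum => k lk; have := lerD (Dle k true lk) (Dle k false lk).
      by move/le_trans; apply; rewrite le_eqVlt; apply/orP; left; apply/eqP; ring.
    by rewrite sumr_const -mulr_natr le_eqVlt; apply/orP; left; apply/eqP; ring.
  rewrite /small !big_distrr /= -big_split; apply: ler_sum => k _ /=.
  rewrite /D; have sq (u v : R) : (u - v) ^+ 2 <= 2 * u ^+ 2 + 2 * v ^+ 2.
    have := sqr_ge0 (u + v); rewrite -subr_ge0 => h; rewrite -subr_ge0.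
    by have -> : 2 * u ^+ 2 + 2 * v ^+ 2 - (u - v) ^+ 2 = (u + v) ^+ 2 - 0 by ring.
  have := lerD (sq (Z i (k, true)) (Z j (k, true)))
    (sq (Z i (k, false)) (Z j (k, false))).
  by move/le_trans; apply; rewrite le_eqVlt; apply/orP; left; apply/eqP; ring.
Qed.

(** * Choice of the parameters *)

(** With x = 128 m K0 / e, take g to be the integer part of x plus 1. Then g^2 >= g > x gives the
    first bound; g <= x + 1 and g + 1 <= exp(g) give the second. *)
Lemma grid_resolution (R : realType) (K0 e : R) (m : nat) :
  0 <= K0 -> 0 < e -> (0 < m)%N ->
  exists g : nat, (0 < g)%N /\ forall K : nat, K%:R <= K0 ->
    8 * K%:R / g%:R ^+ 2 <= e / (16 * m%:R) /\
    (g.+1 ^ (K * 2))%:R <= expR (2 * K0 * (128 * m%:R * K0 / e + 1)).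
Proof.
move=> K0_ge0 e0 m0; have m0R : 0 < m%:R :> R by rewrite ltr0n.
set x := 128 * m%:R * K0 / e.
have x0 : 0 <= x by rewrite divr_ge0 ?mulr_ge0 // ltW.
have /andP[gx xg] := truncn_itv x0.
set g := (Num.trunc x).+1 in xg *; have g1 : 1 <= g%:R :> R by rewrite ler1n.
have gx1 : g%:R <= x + 1 by rewrite /g -natr1 lerD2r.
have g0 : 0 < g%:R :> R by rewrite ltr0n.
exists g; split=> // K KK0; split.
  have le1 : 128 * m%:R * K0 <= e * g%:R ^+ 2.
    rewrite -ler_pdivrMl // mulrC (le_trans (ltW xg)) //.
    by rewrite expr2 ler_peMr // ltW.
  rewrite ler_pdivrMr ?exprn_gt0 // mulrAC ler_pdivlMr ?mulr_gt0 //.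
  apply: le_trans le1; have := ler_wpM2r (ltW m0R) KK0; lra.
apply: (@le_trans _ _ (expR (g%:R * (K * 2)%:R))).
  rewrite natrX expRM_natr lerXn2r ?nnegrE ?expR_ge0 //.
  by rewrite -natr1 addrC expR_ge1Dx.
rewrite ler_expR natrM mulrC [_ * 2]mulrC.
apply: ler_pM => //; first by rewrite mulr_ge0.
by rewrite ler_wpM2l.
Qed.

(** Solving the equation for tau makes K0 a constant times e^(-b) with b = q / (2 - q). The exponent
    in the cell count is then dominated by K0^2 / e, of order e^(-(2b+1)). *)
Lemma threshold_parameters (R : realType) (q C : R) (m : nat) :
  1 <= q -> q < 2 -> 0 < C -> (0 < m)%N ->
  exists c : R, 0 < c /\ forall e : R, 0 < e -> e < 1 ->
  exists tau : R, [/\ 0 < tau,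
    C `^ q * tau `^ (2 - q) = e / (64 * m%:R)
    & forall K0 : R, K0 = (C / tau) `^ q ->
      4 / e * expR (2 * K0 * (128 * m%:R * K0 / e + 1)) <=
      expR (c * e `^ (- (2 * (q / (2 - q)) + 1)))].
Proof.
move=> q1 q2 C0 m0; have m0R : 0 < m%:R :> R by rewrite ltr0n.
have q2' : 0 < 2 - q by lra.
set b := q / (2 - q); have b0 : 0 < b by rewrite divr_gt0 //; lra.
have Cq : 0 < C `^ q by exact: powR_gt0.
pose D := 64 * m%:R * C `^ q; have D0 : 0 < D by rewrite !mulr_gt0.
pose a := C `^ q * D `^ b; have a0 : 0 < a by rewrite mulr_gt0 ?powR_gt0.
(* With E = e^(-(2b+1)): 5 absorbs 4 <= exp(4E) and 1/e <= exp(E), while the other two terms come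
   from K0^2 / e and K0, where K0 = a e^(-b). *)
pose c : R := 5 + 256 * m%:R * a ^+ 2 + 2 * a.
exists c; split.
  have p : 0 < 256 * m%:R * a ^+ 2.
    by apply: mulr_gt0; [exact: mulr_gt0|exact: exprn_gt0].
  rewrite /c; lra.
move=> e e0 e1; have eD : 0 < e / D by rewrite divr_gt0.
exists ((e / D) `^ (2 - q)^-1); split; first exact: powR_gt0.
  rewrite -powRrM mulVf ?gt_eqF // powRr1 ?(ltW eD) // /D; field.
  by rewrite !gt_eqF.
move=> _ ->; set K0 := _ `^ q.
have K0E : K0 = a * e `^ (- b).
  rewrite /K0 powRM ?invr_ge0 ?powR_ge0 ?(ltW C0) // /a -mulrA; congr (_ * _).
  rewrite -powR_inv1 ?powR_ge0 // -!powRrM.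
  have -> : (2 - q)^-1 * (-1 * q) = - b by rewrite /b; field; rewrite gt_eqF.
  rewrite powRM ?invr_ge0 ?(ltW e0) ?(ltW D0) // mulrC; congr (_ * _).
  by rewrite -[D^-1]powR_inv1 ?(ltW D0) // -powRrM mulrNN mul1r.
set E := e `^ _.
have E_b : e `^ (- b) ^+ 2 / e = E.
  rewrite -powR_mulrn ?powR_ge0 // -powRrM -[e^-1]powR_inv1 ?(ltW e0) // -powRD.
    by congr (_ `^ _); ring.
  by rewrite (gt_eqF e0) implybT.
have Eb x : x <= 2 * b + 1 -> e `^ (- x) <= E.
  by move=> xb; apply: ger_powR; [rewrite e0 ltW | rewrite lerN2].
have E1 : 1 <= E by rewrite -(powRr0 e) -oppr0 Eb //; lra.
have Ee : e^-1 <= E by rewrite -powR_inv1 ?(ltW e0) // Eb //; lra.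
have Ebb : e `^ (- b) <= E by rewrite Eb //; lra.
have -> : c * E = 4 * E + E + (c - 5) * E by ring.
rewrite !expRD; apply: ler_pM => //; rewrite ?expR_ge0 ?divr_ge0 ?(ltW e0) //.
  apply: ler_pM; rewrite ?invr_ge0 ?(ltW e0) //.
    by apply: le_trans (expR_ge1Dx _); lra.
  by apply: le_trans (expR_ge1Dx _); lra.
rewrite ler_expR.
have -> : 2 * K0 * (128 * m%:R * K0 / e + 1) =
   256 * m%:R * a ^+ 2 * (e `^ (- b) ^+ 2 / e) + 2 * a * e `^ (- b).
  by rewrite K0E; field; rewrite gt_eqF.
have -> : (c - 5) * E = 256 * m%:R * a ^+ 2 * E + 2 * a * E by rewrite /c; ring.
by rewrite E_b lerD2l; apply: ler_wpM2l => //; apply: mulr_ge0 => //; exact: ltW.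
Qed.

(** * Assembling the constants *)

Theorem theorem1p8 :
  forall (R : realType) (H : sgraph) (q : R), 1 <= q -> q < 2 ->
  exists B : R, 0 < B /\
  forall C : R, 0 < C ->
  exists A : R, 0 < A /\
  forall eps : R, 0 < eps -> eps < 1 ->
  exists delta : R, expR (- (A * eps `^ (- B))) <= delta /\
  forall G : sgraph, (0 < #|G|)%N ->
    eigenvalue_norm q (adjmx R G) <= C * #|G|%:R ->
    (nhom H G)%:R <= delta * #|G|%:R ^+ #|H| ->
    exists F : {set {set G}},
      [/\ F \subset edges G,
          #|F|%:R <= eps * #|G|%:R ^+ 2
        & nhom H (del_edges F) = 0%N].
Proof.
move=> R H q q1 q2; exists (2 * (q / (2 - q)) + 1); split.
  by rewrite addr_gt0 // mulr_gt0 // divr_gt0; lra.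
(* The successor keeps m positive even when H has no vertices. *)
move=> C C0; pose m := (#|H| ^ 2).+1; have m0R : 0 < m%:R :> R by rewrite ltr0n.
have [c [c0 par]] := @threshold_parameters R q C m q1 q2 C0 (ltn0Sn _).
(* Here c pays for one factor [beta] per vertex of H, and 4 for the factor 2 in the homomorphism
   count. *)
exists (4 + #|H|%:R * c); split; first by rewrite ltr_wpDr ?mulr_ge0 ?(ltW c0).
move=> e e0 e1; have [tau [tau0 tauE /(_ _ erefl)]] := par e e0 e1.
set K0 := _ `^ q; set Mbar := expR _; set E := e `^ _ => betaE.
have [g [g0 gP]] := @grid_resolution R K0 e m (powR_ge0 _ _) e0 (ltn0Sn _).
exists (expR (- ((4 + #|H|%:R * c) * E))); split=> // G n0 normG few.
have n0R : 0 < #|G|%:R :> R by rewrite ltr0n.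
have [K [L [c' [r [KK0 cardL sumr rd]]]]] :=
  spectral_cells q1 q2 C0 tau0 g0 n0 normG.
have [gK LM] := gP K KK0; rewrite -cardL -/Mbar in LM.
have Mbar0 : 0 < Mbar by exact: expR_gt0.
have Mbar1 : 1 <= Mbar.
  rewrite -expR0 ler_expR !mulr_ge0 ?addr_ge0 ?divr_ge0 ?mulr_ge0 ?powR_ge0 //.
  exact: ltW.
(* Cells below [beta] n are discarded; there are at most [Mbar] of them, so they cover at most e n /
   4 vertices. *)
pose beta := e / (4 * Mbar).
have beta0 : 0 < beta by rewrite divr_gt0 ?mulr_gt0.
have beta1 : beta <= 1 by rewrite ler_pdivrMr ?mulr_gt0 //; lra.
have beta_ge : expR (- (c * E)) <= beta.
  rewrite expRN /beta -[leRHS]invrK lef_pV2 ?posrE ?invr_gt0 ?expR_gt0 //.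
  by apply: le_trans betaE; rewrite invf_div mulrAC.
have E0 : 1 <= E.
  rewrite -(powRr0 e) -oppr0; apply: ger_powR; first by rewrite e0 ltW.
  by rewrite lerN2 addr_ge0 // mulr_ge0 // divr_ge0; lra.
have [|||||F [FG Fn F0]] := @removal_from_cells R H G L c' m (beta * #|G|%:R).
- by [].
- exact: leqnSn.
- by rewrite mulr_ge0 // ltW.
- by rewrite ler_piMl.
(* Strictness comes from 2 exp(-4E) < 1, valid because E >= 1. *)
- apply: (@le_lt_trans _ _ (2 * expR (- (4 * E)) *
    (expR (- (c * E)) ^+ #|H| * #|G|%:R ^+ #|H|))).
    rewrite -expRM_natl -mulrA ler_wpM2l // mulrA -expRD.
    by apply: le_trans few _; rewrite ler_wpM2r ?exprn_ge0 // ler_expR; lra.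
  rewrite exprMn mulrA ltr_pM2r ?exprn_gt0 //.
  apply: (@le_lt_trans _ _ (2 * expR (- (4 * E)) * beta ^+ #|H|)).
    rewrite ler_wpM2l ?mulr_ge0 ?expR_ge0 // lerXn2r ?nnegrE ?expR_ge0 //.
    exact: ltW.
  rewrite gtr_pMl ?exprn_gt0 // expRN ltr_pdivrMr ?expR_gt0 // mul1r.
  by apply: lt_le_trans (expR_ge1Dx _); lra.
exists F; split=> //; apply: le_trans Fn _.
set n : R := #|G|%:R in n0R rd sumr *.
have le1 : #|L|%:R * (beta * n) <= e / 4 * n.
  have -> : e / 4 * n = Mbar * (beta * n) by rewrite /beta; field; rewrite gt_eqF.
  by rewrite ler_wpM2r // mulr_ge0 // ltW.
have le2 := kernel_row_dist (c := c') rd.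
have le3 : \sum_i \sum_j kernel R c' i j * (row_dist i j)%:R <=
    e / (16 * m%:R) * n * n + 4 * (e / (64 * m%:R) * n ^+ 2).
  apply: le_trans le2 _; apply: lerD; last by rewrite ler_wpM2l // -tauE.
  by rewrite !ler_wpM2r // ltW.
(* The budget is exact: e/2 for small cells, and e/4 each for the rounding error and the small
   eigenvalues, all times n^2. *)
apply: (@le_trans _ _ (2 * n * (e / 4 * n) + (4 * m)%:R *
  (e / (16 * m%:R) * n * n + 4 * (e / (64 * m%:R) * n ^+ 2)))).
  by apply: lerD; rewrite ler_wpM2l // mulr_ge0 // ltW.
rewrite natrM le_eqVlt; apply/orP; left; apply/eqP; field.
by rewrite gt_eqF.
Qed.
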